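(* Let $\alpha\in[0,1]$, let $F_s\ne F_b$ be CDFs on $\mathbb{R}$ and $F=\alpha F_s+(1-\alpha)F_b$. Suppose that $F=\kappa F^{(a)}+(1-\kappa)F^{(d)}$, where $F^{(a)}$ is an absolutely continuous CDF and $F^{(d)}$ is a piecewise constant CDF, for some $\kappa\in(0,1)$, and similarly $F_s=\kappa_sF_s^{(a)}+(1-\kappa_s)F_s^{(d)}$ and $F_b=\kappa_bF_b^{(a)}+(1-\kappa_b)F_b^{(d)}$ with $\kappa_s,\kappa_b\in(0,1)$, where $F_s^{(a)},F_b^{(a)}$ are absolutely continuous CDFs and $F_s^{(d)},F_b^{(d)}$ are piecewise constant CDFs. Then $$\alpha_0=\alpha-\min\left\{\frac{\alpha\kappa_s-\alpha_0^{(a)}\kappa}{\kappa_b},\ \frac{\alpha(1-\kappa_s)-\alpha_0^{(d)}(1-\kappa)}{1-\kappa_b}\right\},$$ where $$\alpha_0=\inf\{\gamma\in(0,1]:[F-(1-\gamma)F_b]/\gamma\text{ is a CDF}\},$$ $$\alpha_0^{(a)}=\inf\{\gamma\in(0,1]:[F^{(a)}-(1-\gamma)F_b^{(a)}]/\gamma\text{ is a CDF}\},$$ $$\alpha_0^{(d)}=\inf\{\gamma\in(0,1]:[F^{(d)}-(1-\gamma)F_b^{(d)}]/\gamma\text{ is a CDF}\}.$$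
   Context: A piecewise constant CDF is the CDF of a purely atomic (discrete) probability measure, i.e. a countable sum of point masses. *)

(* Defs.v *)
From HB Require Import structures.
From mathcomp Require Import all_boot all_order all_algebra.
From mathcomp Require Import all_classical all_reals all_analysis.

Set Implicit Arguments.
Unset Strict Implicit.
Unset Printing Implicit Defensive.

Import Order.TTheory GRing.Theory Num.Theory.
Import numFieldNormedType.Exports.

Local Open Scope classical_set_scope.
Local Open Scope ring_scope.

(* The library's bundled cumulative distribution functions on R: nondecreasing,
   right-continuous, with limits 0 at -oo and 1 at +oo. *)
Notation CDF R := (@CumulativeBounded.type R (0 : R) (1 : R)).

Definition is_cdf (R : realType) (G : R -> R) : Prop :=
  exists f : CDF R, G = f.

(* [lebesgue_stieltjes_measure f] is the probability measure whose cumulative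
   distribution function is f; absolute continuity is meant with respect to
   Lebesgue measure. *)
Definition absolutely_continuous_cdf (R : realType) (f : CDF R) : Prop :=
  lebesgue_stieltjes_measure f `<< (@lebesgue_measure R).

(* The measure of f is a countable sum of point masses p k at a k.  The points
   need not be distinct and weights may vanish, so finite sums are included;
   the weights sum to 1 because f is a CDF. *)
Definition piecewise_constant_cdf (R : realType) (f : CDF R) : Prop :=
  exists (a : nat -> R) (p : nat -> {nonneg R}),
    forall A : set R, measurable A ->
      lebesgue_stieltjes_measure f A =
      mseries (fun k => mscale (p k) (dirac (a k))) 0 A.

Definition mixture (R : realType) (w : R) (G H : R -> R) : R -> R :=
  fun x => w * G x + (1 - w) * H x.

Definition alpha0 (R : realType) (G Gb : R -> R) : R :=
  inf [set gamma : R | 0 < gamma <= 1 /\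
        is_cdf (fun x => (G x - (1 - gamma) * Gb x) / gamma)].

(* Main.v *)
Require Import Defs.
From HB Require Import structures.
From mathcomp Require Import all_boot all_order all_algebra.
From mathcomp Require Import all_classical all_reals all_analysis.
From mathcomp Require Import ring lra.
Import Order.TTheory GRing.Theory Num.Theory.
Import numFieldNormedType.Exports.
Local Open Scope classical_set_scope.
Local Open Scope ring_scope.

(* Passing from CDFs to measures, [alpha0 G H <= c] holds exactly when
   (1 - c) mu_H <= mu_G.  The measures of the absolutely continuous parts and of
   the atomic parts live on disjoint sets, namely the complement of a countable
   set C and C itself, so (1 - c) mu_Fb <= mu_F splits into the corresponding
   inequalities for the two parts, each of which is again a bound on an alpha0.
   Evaluating mu_F at the complement of C gives
   kappa = alpha kappa_s + (1 - alpha) kappa_b, which turns the two bounds into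
   the stated minimum. *)

Lemma countable_setU (T : Type) (A B : set T) :
  countable A -> countable B -> countable (A `|` B).
Proof.
by move=> cA cB; rewrite -bigcup2E; apply: bigcup_countable => // -[|[|n]].
Qed.

Definition prob {R : realType} (f : CDF R) (A : set R) : R :=
  fine (lebesgue_stieltjes_measure f A).

Section prob.
Context {R : realType}.
Implicit Types (f g h : CDF R) (A B : set R).

(** * Measures of CDFs, of their mixtures and of their residuals *)

Lemma probE f A : measurable A -> lebesgue_stieltjes_measure f A = (prob f A)%:E.
Proof. by move=> mA; rewrite /prob fineK// fin_num_measure. Qed.

Lemma prob_ge0 f A : 0 <= prob f A.
Proof. by rewrite /prob fine_ge0. Qed.

Lemma probT f : prob f setT = 1.
Proof. by rewrite /prob (@probability_setT _ _ _ (lebesgue_stieltjes_measure f)). Qed.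

Lemma prob_itv f (a b : R) : a <= b -> prob f `]a, b]%classic = f b - f a.
Proof.
move=> ab; rewrite /prob /lebesgue_stieltjes_measure /measure_extension.
rewrite measurable_mu_extE/=; last exact: is_ocitv.
by rewrite wlength_itv_bnd.
Qed.

Lemma prob_setIC f A B : measurable A -> measurable B ->
  prob f A = prob f (A `&` B) + prob f (A `&` ~` B).
Proof.
move=> mA mB; apply: EFin_inj; rewrite EFinD -!probE//.
- rewrite -measureU//.
  + by rewrite -setIUr setUCr setIT.
  + exact: measurableI.
  + by apply: measurableI => //; exact: measurableC.
  + by rewrite setIACA setICr setI0.
- by apply: measurableI => //; exact: measurableC.
- exact: measurableI.
Qed.

Lemma le_prob f A B : measurable A -> measurable B -> A `<=` B ->
  prob f A <= prob f B.
Proof.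
move=> mA mB AB; rewrite -lee_fin -!probE//.
by apply: le_measure; rewrite ?inE.
Qed.

(** The weighted sum of the two measures agrees with the measure of [f] on the intervals []a, b]],
    and these determine a Lebesgue-Stieltjes measure. *)
Lemma prob_mixture f g h (w : R) : 0 <= w <= 1 ->
  (f : R -> R) = mixture w g h -> forall A, measurable A ->
  prob f A = w * prob g A + (1 - w) * prob h A.
Proof.
move=> /andP[w0 w1] fE A mA.
have w1' : 0 <= 1 - w by rewrite subr_ge0.
pose mu := measure_add (mscale (NngNum w0) (lebesgue_stieltjes_measure g))
  (mscale (NngNum w1') (lebesgue_stieltjes_measure h)).
have muE B : measurable B -> mu B = (w * prob g B + (1 - w) * prob h B)%:E.
  by move=> mB; rewrite EFinD !EFinM -!probE// /mu measure_addE.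
apply: EFin_inj; rewrite -probE// -muE//.
apply: lebesgue_stieltjes_measure_unique => // _ [[a b] _ <-] /=.
have mab : measurable `]a, b]%classic by exact: measurable_itv.
apply: etrans (probE _ _ mab) _; apply/esym; apply: etrans (muE _ mab) _.
have [ab|/ltW ba] := leP a b.
  by rewrite !prob_itv// fE /mixture; congr EFin; ring.
have -> : `]a, b]%classic = set0 :> set R by rewrite set_itv_ge// bnd_simp -leNgt.
by rewrite /prob !measure0/= !mulr0 addr0.
Qed.

(** Right-continuity and limits at infinity pass to linear combinations of any sign, so monotonicity
    alone has to be assumed. Residuals have a coefficient [- ((1 - c) / c)]. *)
Lemma is_cdf_affine g h (a b : R) : a + b = 1 ->
  nondecreasing (fun x => a * g x + b * h x) ->
  is_cdf (fun x => a * g x + b * h x).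
Proof.
move=> ab1 nd; pose u x := a * g x + b * h x.
have cvgu (F : set_system R) (x y : R) : Filter F ->
    g @ F --> x -> h @ F --> y -> u @ F --> a * x + b * y.
  by move=> FF gx hy; apply: cvgD; apply: cvgM => //; exact: cvg_cst.
have rc : right_continuous u.
  by move=> x; apply: cvgu; exact: cumulative_is_right_continuous.
have u0 : u @ -oo --> (0 : R).
  rewrite -[0 in X in _ --> X](_ : a * 0 + b * 0 = 0); last by rewrite !mulr0 addr0.
  by apply: cvgu; exact: cumulativeNy.
have u1 : u @ +oo --> (1 : R).
  rewrite -ab1 -[a in X in _ --> X]mulr1 -[b in X in _ --> X]mulr1.
  by apply: cvgu; exact: cumulativey.
pose f : CDF R := HB.pack u (isCumulative.Build R _ R u nd rc)
  (isCumulativeBounded.Build R 0 1 u u0 u1).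
by exists f.
Qed.

Lemma is_cdf_mixture g h (w : R) : 0 <= w <= 1 -> is_cdf (mixture w g h).
Proof.
move=> /andP[w0 w1]; apply: is_cdf_affine; first by ring.
move=> x y xy; apply: lerD; apply: ler_wpM2l; rewrite ?subr_ge0//;
  exact: cumulative_is_nondecreasing.
Qed.

(** If the residual is a CDF [r], then [g] is the mixture of [r] and [h] with weight [c].
    Conversely, domination on the intervals []x, y]] is monotonicity of the residual. *)
Lemma is_cdf_residualP g h (c : R) : 0 < c <= 1 ->
  is_cdf (fun x => (g x - (1 - c) * h x) / c) <->
  forall A, measurable A -> (1 - c) * prob h A <= prob g A.
Proof.
move=> /andP[c0 c1]; have cn0 : c != 0 by rewrite gt_eqF.
split=> [[r rE] A mA|dom].
  have gE : (g : R -> R) = mixture c r h.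
    by apply/funext => x; rewrite /mixture -rE; field.
  by rewrite (prob_mixture _ _ _ _ _ gE)// ?(ltW c0)// lerDr mulr_ge0 ?prob_ge0// ltW.
rewrite (_ : (fun _ => _) = (fun x => c^-1 * g x + (- ((1 - c) / c)) * h x));
  last by apply/funext => x; field.
apply: is_cdf_affine; first by field.
move=> x y xy; have := dom `]x, y]%classic (measurable_itv _).
rewrite !prob_itv// => gh.
rewrite -subr_ge0 (_ : _ - _ =
  (g y - g x - (1 - c) * (h y - h x)) / c); last by field.
by rewrite divr_ge0 ?subr_ge0// ltW.
Qed.

(** * Upper bounds on [alpha0] *)

Lemma prob_le1 f A : measurable A -> prob f A <= 1.
Proof. by move=> mA; rewrite -(probT f); apply: le_prob. Qed.

(* [c] is arbitrary: at [c <= 0] or [c > 1] no residual CDF is available, and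
   at [c = 0] the infimum need not be attained. *)
Lemma alpha0_leP g h (c : R) :
  alpha0 g h <= c <->
  forall A, measurable A -> (1 - c) * prob h A <= prob g A.
Proof.
rewrite /alpha0; set S := [set _ | _].
have SP d : 0 < d <= 1 ->
    (forall A, measurable A -> (1 - d) * prob h A <= prob g A) -> S d.
  by move=> d01 dom; split => //; apply/is_cdf_residualP.
have S1 : S 1.
  by apply: SP => [|A mA]; rewrite ?ltr01 ?lexx// subrr mul0r prob_ge0.
have infS : has_inf S.
  by split; [exists 1 | exists 0 => x [/andP[/ltW]]].
split=> [le_c A mA|dom].
  apply/ler_addgt0Pr => e e0.
  (* Since [d < c + e] and [prob h A <= 1], replacing [d] by [c] costs at most [e]. *)
  have [d [d01 /is_cdf_residualP-/(_ d01)/(_ A mA) dA] lt_d] :=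
    inf_adherent e0 infS.
  have := prob_ge0 h A; have := prob_le1 h A mA.
  move: lt_d le_c dA; set i := inf S; nra.
(* Testing on the whole line forces [c >= 0], so [c + e] is positive; it is an admissible weight
   unless it exceeds 1, and then the weight 1 serves. *)
have c0 : 0 <= c.
  by have := dom _ (@measurableT _ _); rewrite !probT; lra.
apply/ler_addgt0Pr => e e0.
have [ce1|ce1] := leP (c + e) 1; last first.
  by apply: le_trans (ltW ce1); apply: ge_inf => //; case: infS.
apply: ge_inf; first by case: infS.
apply: SP; first by apply/andP; split => //; lra.
by move=> A mA; have := dom A mA; have := prob_ge0 h A; nra.
Qed.

(** * Separation of absolutely continuous and atomic parts *)

Lemma absolutely_continuous_prob0 f A : absolutely_continuous_cdf f ->
  countable A -> measurable A -> prob f A = 0.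
Proof.
move=> fac cA mA; apply: EFin_inj; rewrite -probE//.
apply: (fac A) => //; apply/measure0_null_setP => //.
exact: countable_lebesgue_measure0.
Qed.

Lemma piecewise_constant_support f : piecewise_constant_cdf f ->
  exists2 C, countable C & prob f (~` C) = 0.
Proof.
move=> [a [p fE]]; have cC : countable (range a) by apply: card_image_le.
exists (range a) => //.
have mC : measurable (~` range a).
  by apply/measurableC/countable_measurable.
rewrite /prob fE// /mseries eseries0// => i _ _.
apply: (etrans (y := ((p i)%:num%:E * \d_(a i) (~` range a))%E)) => //.
by rewrite diracE memNset ?mule0//=; apply; exists i.
Qed.

Lemma prob_setI0 f A B : measurable A -> measurable B ->
  prob f B = 0 -> prob f (A `&` B) = 0.
Proof.
move=> mA mB fB0; apply/le_anti; rewrite prob_ge0 -fB0 le_prob//.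
exact: measurableI.
Qed.

(** Testing on [A] minus [C] kills the second pair of measures and leaves the first unchanged;
    testing on the intersection with [C] does the reverse. *)
Lemma mutually_singular_le (g1 g2 h1 h2 : CDF R) (C : set R) (a b c d : R) :
  measurable C ->
  prob g1 C = 0 -> prob h1 C = 0 ->
  prob g2 (~` C) = 0 -> prob h2 (~` C) = 0 ->
  (forall A, measurable A ->
    c * prob h1 A + d * prob h2 A <= a * prob g1 A + b * prob g2 A) <->
  (forall A, measurable A -> c * prob h1 A <= a * prob g1 A) /\
  (forall A, measurable A -> d * prob h2 A <= b * prob g2 A).
Proof.
move=> mC g1C h1C g2C h2C; have mNC := measurableC mC.
split=> [le_hg|[le1 le2] A mA]; last by rewrite lerD ?le1 ?le2.
split=> A mA.
- have := le_hg _ (measurableI _ _ mA mNC).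
  rewrite (prob_setI0 h2)// (prob_setI0 g2)// !mulr0 !addr0.
  by rewrite (prob_setIC h1 A C)// (prob_setIC g1 A C)// !(prob_setI0 _ A C)// !add0r.
- have := le_hg _ (measurableI _ _ mA mC).
  rewrite (prob_setI0 h1)// (prob_setI0 g1)// !mulr0 !add0r.
  by rewrite (prob_setIC h2 A C)// (prob_setIC g2 A C)// !(prob_setI0 _ A (~` C))// !addr0.
Qed.

Lemma alpha0_mixture_le (f fb fa fd fba fbd : CDF R) (C : set R) (k kb c : R) :
  0 < k < 1 -> 0 < kb < 1 ->
  (f : R -> R) = mixture k fa fd -> (fb : R -> R) = mixture kb fba fbd ->
  measurable C -> prob fa C = 0 -> prob fba C = 0 ->
  prob fd (~` C) = 0 -> prob fbd (~` C) = 0 ->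
  alpha0 f fb <= c <->
  (1 - c) * kb <= (1 - alpha0 fa fba) * k /\
  (1 - c) * (1 - kb) <= (1 - alpha0 fd fbd) * (1 - k).
Proof.
move=> /andP[k0 k1] /andP[kb0 kb1] fE fbE mC faC fbaC fdC fbdC.
(* Dividing by [u] gives [alpha0_leP] at [1 - v / u], a number that may lie outside the unit
   interval. *)
have scaled (g h : CDF R) (u v : R) : 0 < u ->
    (forall A, measurable A -> v * prob h A <= u * prob g A) <->
    v <= (1 - alpha0 g h) * u.
  move=> u0; have un0 : u != 0 by rewrite gt_eqF.
  have -> : (v <= (1 - alpha0 g h) * u) = (alpha0 g h <= 1 - v / u).
    by rewrite -ler_pdivrMr// lerBrDr -lerBrDl addrC.
  rewrite alpha0_leP subKr; split=> dom A mA; have := dom A mA.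
    by rewrite mulrAC ler_pdivrMr// [u * _]mulrC.
  by rewrite mulrAC ler_pdivrMr// [u * _]mulrC.
rewrite alpha0_leP -!scaled ?subr_gt0// -(mutually_singular_le _ _ _ _ C)//.
have kw : 0 <= k <= 1 by rewrite !ltW.
have kbw : 0 <= kb <= 1 by rewrite !ltW.
by split=> le_fb A mA; have := le_fb A mA;
  rewrite (prob_mixture f fa fd k kw fE)// (prob_mixture fb fba fbd kb kbw fbE)//;
  rewrite [(1 - c) * (_ * _ + _)]mulrDr !mulrA.
Qed.

End prob.

Theorem lemma10 (R : realType) (alpha kappa kappa_s kappa_b : R)
    (F : R -> R) (Fs Fb Fa Fd Fsa Fsd Fba Fbd : CDF R)
    (halpha : 0 <= alpha <= 1)
    (hsb : (Fs : R -> R) <> (Fb : R -> R))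
    (hF : F = mixture alpha Fs Fb)
    (hkappa : 0 < kappa < 1)
    (hkappa_s : 0 < kappa_s < 1)
    (hkappa_b : 0 < kappa_b < 1)
    (hFad : F = mixture kappa Fa Fd)
    (hFsad : (Fs : R -> R) = mixture kappa_s Fsa Fsd)
    (hFbad : (Fb : R -> R) = mixture kappa_b Fba Fbd)
    (hFa : absolutely_continuous_cdf Fa)
    (hFsa : absolutely_continuous_cdf Fsa)
    (hFba : absolutely_continuous_cdf Fba)
    (hFd : piecewise_constant_cdf Fd)
    (hFsd : piecewise_constant_cdf Fsd)
    (hFbd : piecewise_constant_cdf Fbd) :
  alpha0 F Fb =
  alpha - Num.min
    ((alpha * kappa_s - alpha0 Fa Fba * kappa) / kappa_b)
    ((alpha * (1 - kappa_s) - alpha0 Fd Fbd * (1 - kappa)) / (1 - kappa_b)).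
Proof.
have [Cd cCd FdCd] := piecewise_constant_support Fd hFd.
have [Cs cCs FsdCs] := piecewise_constant_support Fsd hFsd.
have [Cb cCb FbdCb] := piecewise_constant_support Fbd hFbd.
(* One countable set carries all three atomic parts, and it is null for the absolutely continuous
   ones. *)
pose C := Cd `|` Cs `|` Cb.
have cC : countable C by apply: countable_setU => //; exact: countable_setU.
have mC : measurable C by apply: countable_measurable.
have mNC := measurableC mC.
have atomic f D : D `<=` C -> countable D -> prob f (~` D) = 0 -> prob f (~` C) = 0.
  move=> DC cD fD0; apply/le_anti; rewrite prob_ge0 -fD0 le_prob//.
  - by apply/measurableC/countable_measurable.
  - exact: subsetC.
have acT f : absolutely_continuous_cdf f -> prob f (~` C) = 1.
  move=> fac; have := prob_setIC f setT C measurableT mC.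
  by rewrite probT !setTI absolutely_continuous_prob0// add0r => <-.
have FdC : prob Fd (~` C) = 0 by apply: (atomic _ Cd) => // x Dx; left; left.
have FsdC : prob Fsd (~` C) = 0 by apply: (atomic _ Cs) => // x Dx; left; right.
have FbdC : prob Fbd (~` C) = 0 by apply: (atomic _ Cb) => // x Dx; right.
have [f fE] := is_cdf_mixture Fs Fb alpha halpha.
rewrite -hF in fE.
have w01 (w : R) : 0 < w < 1 -> 0 <= w <= 1 by move=> /andP[/ltW-> /ltW->].
(* Both decompositions of [F] are evaluated at the complement of [C], which has mass 1 under the
   absolutely continuous parts and 0 under the atomic ones. *)
have kappaE : kappa = alpha * kappa_s + (1 - alpha) * kappa_b.
  have : prob f (~` C) = kappa.
    rewrite (prob_mixture f Fa Fd kappa)//; [|exact: w01|by rewrite -fE].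
    by rewrite acT// FdC mulr1 mulr0 addr0.
  rewrite (prob_mixture f Fs Fb alpha)//; last by rewrite -fE.
  rewrite (prob_mixture Fs Fsa Fsd kappa_s)//; last exact: w01.
  rewrite (prob_mixture Fb Fba Fbd kappa_b)//; last exact: w01.
  by rewrite (acT Fsa)// (acT Fba)// FsdC FbdC !mulr1 !mulr0 !addr0 => <-.
have le_alpha0 c : alpha0 F Fb <= c <->
    (1 - c) * kappa_b <= (1 - alpha0 Fa Fba) * kappa /\
    (1 - c) * (1 - kappa_b) <= (1 - alpha0 Fd Fbd) * (1 - kappa).
  rewrite fE; apply: (alpha0_mixture_le f Fb Fa Fd Fba Fbd C) => //;
    rewrite -?fE//; exact: absolutely_continuous_prob0.
have /andP[kb0 kb1] := hkappa_b.
(* The right side is at most [c] when [alpha - c] is below both quotients. Clearing denominators and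
   substituting [kappaE] turns this into the two bounds of [le_alpha0]. *)
have le_rhs c : alpha - Num.min
    ((alpha * kappa_s - alpha0 Fa Fba * kappa) / kappa_b)
    ((alpha * (1 - kappa_s) - alpha0 Fd Fbd * (1 - kappa)) / (1 - kappa_b)) <= c
    <-> alpha0 F Fb <= c.
  rewrite le_alpha0 lerBlDr -lerBlDl le_min !ler_pdivlMr ?subr_gt0//.
  rewrite kappaE; split=> [/andP[]|[]]; last (move=> ? ?; apply/andP); split; lra.
(* Two reals with the same upper bounds are equal: [c] is taken to be each side in turn. *)
by apply/le_anti/andP; split; [apply/le_rhs|apply/le_rhs].
Qed.
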